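(* Let $p(t)\in\mathbb{R}^3$ be the position of a vehicle, let $p_1,\dots,p_n\in\mathbb{R}^3$ and $R_1,\dots,R_n\in\mathbb{SO}(3)$ be the known fixed positions and orientations of $n$ stationary cameras, and let $$y_i(t)=R_i^\top\frac{p(t)-p_i}{\|p(t)-p_i\|},\qquad i=1,\dots,n,$$ be the bearing measurements. Let $C_p(t)$ be the matrix obtained by stacking the $3\times3$ blocks $\Pi(y_1(t))R_1^\top,\dots,\Pi(y_n(t))R_n^\top$ and, if an altimeter is used, the additional row $e_3^\top$. Let $m$ be the number of rows of $C_p(t)$ and let $$A=\begin{bmatrix}0_{3\times 3}&I_3&0_{3\times 3}\\0_{3\times 3}&0_{3\times 3}&I_3\\0_{3\times 3}&0_{3\times 3}&0_{3\times 3}\end{bmatrix},\qquad C(t)=[C_p(t),\,0_{m\times3},\,0_{m\times3}].$$ Then $(A,C(\cdot))$ is uniformly observable if and only if there exist $\delta,\mu>0$ such that for all $t\ge0$ one has $$\frac1\delta\int_t^{t+\delta}\sum_{i=1}^n\Pi(R_iy_i(s))\,ds+\alpha\, e_3e_3^\top\ge\mu I_3,$$ where $\alpha=1$ if the altimeter is used and $\alpha=0$ otherwise.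
   Context: $e_3=[0,0,1]^\top$; $\Pi(z)=I_3-zz^\top$ for unit vectors $z\in\mathbb{S}^2\subset\mathbb{R}^3$. The bearings are assumed well defined, i.e. $p(t)\ne p_i$ for all $t\ge 0$ and all $i$. The pair $(A,C(\cdot))$ is uniformly observable if there exist $\delta,\mu>0$ such that for all $t\ge0$, $\int_t^{t+\delta}\Phi^\top(s,t)C^\top(s)C(s)\Phi(s,t)\,ds\ge\mu I_9$, where $\Phi(s,t)=\exp(A(s-t))$. Matrix inequalities are in the positive semidefinite order. Since $\Pi(y_i)R_i^\top(p-p_i)=0$, the known vector obtained by stacking $\Pi(y_i)R_i^\top p_i$ (together with the altimeter output $e_3^\top p$, if used) equals $C_p(t)p$. *)

(* Defs.v *)
From HB Require Import structures.
From mathcomp Require Import all_boot all_order all_algebra.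
From mathcomp Require Import all_classical all_reals all_analysis.

Set Implicit Arguments.
Unset Strict Implicit.
Unset Printing Implicit Defensive.

Import Order.TTheory GRing.Theory Num.Theory.
Import numFieldNormedType.Exports.

Local Open Scope classical_set_scope.
Local Open Scope ring_scope.

Section Matrices.
Context {R : realType}.

(* The library norm `|x| on matrices is the maximum norm. *)
Definition enorm n (x : 'cV[R]_n) : R := Num.sqrt (\sum_i x i 0 ^+ 2).

Definition SO3 : set 'M[R]_3 := [set Q | Q^T *m Q = 1%:M /\ \det Q = 1].

Definition psdmx n (M : 'M[R]_n) : Prop :=
  M^T = M /\ forall x : 'cV[R]_n, 0 <= (x^T *m M *m x) 0 0.

Definition loewner_le n (M N : 'M[R]_n) : Prop := psdmx (N - M).

(* The limit is taken in the entrywise topology of the library. *)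
Definition expmx n (M : 'M[R]_n) : 'M[R]_n :=
  limn (series (fun k => (k`!%:R)^-1 *: M ^+ k)).

Definition integralmx m n (D : set R) (F : R -> 'M[R]_(m, n)) : 'M[R]_(m, n) :=
  \matrix_(i, j) \int[lebesgue_measure]_(s in D) F s i j.

Definition transition n (A : 'M[R]_n) (s t : R) : 'M[R]_n :=
  expmx ((s - t) *: A).

Definition uniformly_observable m n (A : 'M[R]_n) (C : R -> 'M[R]_(m, n)) :
    Prop :=
  exists delta mu : R, [/\ 0 < delta, 0 < mu & forall t : R, 0 <= t ->
    loewner_le mu%:M
      (integralmx `[t, t + delta]
        (fun s => (transition A s t)^T *m (C s)^T *m C s *m transition A s t))].

End Matrices.

Section Bearings.
Context {R : realType}.

Definition e3 : 'cV[R]_3 := delta_mx ord_max 0.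

Definition Pi (z : 'cV[R]_3) : 'M[R]_3 := 1%:M - z *m z^T.

(* Bearing, in the frame of a camera at c with orientation Q, of the point x. *)
Definition bearing (Q : 'M[R]_3) (c x : 'cV[R]_3) : 'cV[R]_3 :=
  Q^T *m ((enorm (x - c))^-1 *: (x - c)).

(* The boolean alt, coerced to 0 or 1, is also the number of altimeter rows, *)
(* so that the last block is e3^T if alt holds and has no row otherwise.     *)
Definition Cp n (alt : bool) (Q : 'I_n -> 'M[R]_3) (c : 'I_n -> 'cV[R]_3)
    (x : 'cV[R]_3) : 'M[R]_(\sum_(i < n) 3 + alt, 3) :=
  col_mx (\mxcol_(i < n) (Pi (bearing (Q i) (c i) x) *m (Q i)^T))
         (\matrix_(k < alt, j < 3) e3^T 0 j).

Definition Amx : 'M[R]_(3 + (3 + 3)) :=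
  block_mx 0 (row_mx 1%:M 0)
           0 (block_mx 0 1%:M
                       0 0).

Definition Cmx m (P : 'M[R]_(m, 3)) : 'M[R]_(m, 3 + (3 + 3)) :=
  row_mx P (row_mx 0 0).

End Bearings.

(* Main.v *)
(* Since A is nilpotent, the observability Gramian on [t, t + delta'] evaluated
   at (x1, x2, x3) is the integral of q^T M q, where
   q(s) = x1 + (s - t) x2 + (s - t)^2/2 x3 and M = C_p^T C_p is the sum of the
   projections Pi(R_i y_i) plus alpha e3 e3^T. Taking x2 = x3 = 0 gives the
   direct implication. Conversely, let delta be the window of the excitation
   condition and u = K delta with K large. On each of the three windows of
   length delta starting at t, t + u and t + 2u the curve q is nearly constant
   relative to the size of (x1, u x2, u^2/2 x3), so each window contributes about
   mu |q|^2 at its left end; and a quadratic polynomial is determined by its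
   values at 0, u and 2u, so the three contributions bound |x1|, |x2|, |x3|. *)
Require Import Defs.
From HB Require Import structures.
From mathcomp Require Import all_boot all_order all_algebra.
From mathcomp Require Import all_classical all_reals all_analysis.
From mathcomp Require Import measurable_realfun ring lra.

Set Implicit Arguments.
Unset Strict Implicit.
Unset Printing Implicit Defensive.

Import Order.TTheory GRing.Theory Num.Theory.
Import numFieldNormedType.Exports.

Local Open Scope classical_set_scope.
Local Open Scope ring_scope.

(** * Bounded measurable functions and their integrals over compact intervals *)

Section BoundedMeasurable.
Context {R : realType}.
Implicit Types (D : set R) (f g : R -> R).

(** Unlike integrability, this property is stable under products, and on a compact interval it
    implies integrability. Integrability goals below are reduced to it. *)
Definition bounded_measurable D f : Prop :=
  measurable_fun D f /\ exists K, forall x, D x -> `|f x| <= K.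

Lemma bounded_measurable_cst D (k : R) : bounded_measurable D (fun=> k).
Proof. by split; [exact: measurable_cst | exists `|k|]. Qed.

Lemma bounded_measurableD D f g : bounded_measurable D f ->
  bounded_measurable D g -> bounded_measurable D (fun x => f x + g x).
Proof.
move=> [mf [K fK]] [mg [L gL]]; split; first exact: measurable_funD.
by exists (K + L) => x Dx; rewrite (le_trans (ler_normD _ _))// lerD ?fK ?gL.
Qed.

Lemma bounded_measurableM D f g : bounded_measurable D f ->
  bounded_measurable D g -> bounded_measurable D (fun x => f x * g x).
Proof.
move=> [mf [K fK]] [mg [L gL]]; split; first exact: measurable_funM.
by exists (K * L) => x Dx; rewrite normrM ler_pM ?fK ?gL.
Qed.

Lemma bounded_measurable_sum D (I : Type) (r : seq I) (F : I -> R -> R) :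
  (forall i, bounded_measurable D (F i)) ->
  bounded_measurable D (fun x => \sum_(i <- r) F i x).
Proof.
move=> FD; elim: r => [|i r IHr].
  by under eq_fun do rewrite big_nil; exact: bounded_measurable_cst.
by under eq_fun do rewrite big_cons; exact: bounded_measurableD.
Qed.

Lemma eq_bounded_measurable D f g : {in D, f =1 g} ->
  bounded_measurable D f -> bounded_measurable D g.
Proof.
move=> fg [mf [K fK]]; split; first exact: eq_measurable_fun mf.
by exists K => x Dx; rewrite -fg ?fK// inE.
Qed.

Lemma sub_bounded_measurable D E f : measurable E -> D `<=` E ->
  bounded_measurable E f -> bounded_measurable D f.
Proof.
move=> mE DE [mf [K fK]]; split; first exact: measurable_funS mf.
by exists K => x /DE; exact: fK.
Qed.

Lemma bounded_measurable_id a b : bounded_measurable `[a, b] (fun x => x).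
Proof.
split; first exact: measurable_id.
exists (`|a| + `|b|) => x /=; rewrite in_itv/= => /andP[ax xb].
rewrite ler_norml; have := ler_norm a; have := ler_norm b.
have := ler_normr; have := normr_ge0 a; have := normr_ge0 b.
have := ler_norm (- a); rewrite normrN => *; apply/andP; split; lra.
Qed.

Lemma integrable_bounded_measurable a b f : bounded_measurable `[a, b] f ->
  lebesgue_measure.-integrable `[a, b] (EFin \o f).
Proof.
move=> [mf [K fK]]; apply: measurable_bounded_integrable => //=.
- by rewrite lebesgue_measure_itv/=; case: ifP => // _; rewrite ltry.
- exists K; split; first exact: num_real.
  by move=> M KM x /fK /le_trans; apply; exact: ltW.
Qed.

Definition bounded_measurable_mx m n D (F : R -> 'M[R]_(m, n)) : Prop :=
  forall i j, bounded_measurable D (fun x => F x i j).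

Lemma bounded_measurable_mulmx m n k D (F : R -> 'M[R]_(m, n))
    (G : R -> 'M[R]_(n, k)) :
  bounded_measurable_mx D F -> bounded_measurable_mx D G ->
  bounded_measurable_mx D (fun x => F x *m G x).
Proof.
move=> FD GD i j; under eq_fun do rewrite mxE.
by apply: bounded_measurable_sum => l; exact: bounded_measurableM.
Qed.

Lemma bounded_measurable_tr m n D (F : R -> 'M[R]_(m, n)) :
  bounded_measurable_mx D F -> bounded_measurable_mx D (fun x => (F x)^T).
Proof. by move=> FD i j; under eq_fun do rewrite mxE. Qed.

Lemma bounded_measurable_cstmx m n D (M : 'M[R]_(m, n)) :
  bounded_measurable_mx D (fun=> M).
Proof. by move=> i j; exact: bounded_measurable_cst. Qed.

Lemma bounded_measurable_addmx m n D (F G : R -> 'M[R]_(m, n)) :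
  bounded_measurable_mx D F -> bounded_measurable_mx D G ->
  bounded_measurable_mx D (fun x => F x + G x).
Proof.
move=> FD GD i j.
apply: (@eq_bounded_measurable _ (fun x => F x i j + G x i j)) => [x _|].
  by rewrite mxE.
exact: bounded_measurableD.
Qed.

Lemma bounded_measurable_scalemx m n D f (F : R -> 'M[R]_(m, n)) :
  bounded_measurable D f -> bounded_measurable_mx D F ->
  bounded_measurable_mx D (fun x => f x *: F x).
Proof.
move=> fD FD i j.
apply: (@eq_bounded_measurable _ (fun x => f x * F x i j)) => [x _|].
  by rewrite mxE.
exact: bounded_measurableM.
Qed.

Lemma bounded_measurable_row_mx m n1 n2 D (F : R -> 'M[R]_(m, n1))
    (G : R -> 'M[R]_(m, n2)) :
  bounded_measurable_mx D F -> bounded_measurable_mx D G ->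
  bounded_measurable_mx D (fun x => row_mx (F x) (G x)).
Proof.
move=> FD GD i j; case: (split_ordP j) => k ->.
  by apply: eq_bounded_measurable (FD i k) => x _; rewrite row_mxEl.
by apply: eq_bounded_measurable (GD i k) => x _; rewrite row_mxEr.
Qed.

Lemma bounded_measurable_col_mx m1 m2 n D (F : R -> 'M[R]_(m1, n))
    (G : R -> 'M[R]_(m2, n)) :
  bounded_measurable_mx D F -> bounded_measurable_mx D G ->
  bounded_measurable_mx D (fun x => col_mx (F x) (G x)).
Proof.
move=> FD GD i j; case: (split_ordP i) => k ->.
  by apply: eq_bounded_measurable (FD k j) => x _; rewrite col_mxEu.
by apply: eq_bounded_measurable (GD k j) => x _; rewrite col_mxEd.
Qed.

Lemma bounded_measurable_mxcol m n (q : 'I_m -> nat) D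
    (F : forall i, R -> 'M[R]_(q i, n)) :
  (forall i, bounded_measurable_mx D (F i)) ->
  bounded_measurable_mx D (fun x => \mxcol_i F i x).
Proof.
move=> FD i j; apply: eq_bounded_measurable (FD _ _ j) => x _.
by rewrite mxE.
Qed.

Lemma Rintegral_cst_itv (a delta k : R) : 0 <= delta ->
  \int[lebesgue_measure]_(x in `[a, a + delta]) k = k * delta.
Proof.
rewrite le_eqVlt => /predU1P[<-|d0].
  by rewrite addr0 set_itv1 Rintegral_set1 mulr0.
rewrite Rintegral_cst//; congr (_ * _).
rewrite -[LHS]/(fine (lebesgue_measure `[a, a + delta]%classic)).
by rewrite lebesgue_measure_itv/= lte_fin ltrDl d0/= addrAC subrr add0r.
Qed.

Lemma Rintegral_sum a b (I : Type) (r : seq I) (F : I -> R -> R) :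
  (forall i, bounded_measurable `[a, b] (F i)) ->
  \int[lebesgue_measure]_(x in `[a, b]) (\sum_(i <- r) F i x) =
  \sum_(i <- r) \int[lebesgue_measure]_(x in `[a, b]) F i x.
Proof.
move=> FD; elim: r => [|i r IHr].
  under eq_Rintegral do rewrite big_nil.
  by rewrite big_nil Rintegral_cst// mul0r.
under eq_Rintegral do rewrite big_cons.
rewrite big_cons -IHr RintegralD//; apply: integrable_bounded_measurable => //.
exact: bounded_measurable_sum.
Qed.

Lemma Rintegral_subset (a b c d : R) f : a <= c -> d <= b ->
  (forall x, `[a, b]%classic x -> 0 <= f x) -> bounded_measurable `[a, b] f ->
  \int[lebesgue_measure]_(x in `[c, d]) f x <=
  \int[lebesgue_measure]_(x in `[a, b]) f x.
Proof.
move=> ac db f0 fD; have sub : `[c, d] `<=` `[a, b].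
  by apply: subset_itv; rewrite bnd_simp.
have iab := integrable_bounded_measurable fD.
rewrite /Rintegral; apply: fine_le.
- by apply: integrable_fin_num => //; exact: integrableS iab.
- exact: integrable_fin_num.
- by apply: ge0_subset_integral => //; case/integrableP: iab.
Qed.

End BoundedMeasurable.

(** * Quadratic forms, Gram matrices and the order against scalar matrices *)

Section QuadraticForms.
Context {R : realType}.

Definition qform n (M : 'M[R]_n) (x : 'cV[R]_n) : R := (x^T *m M *m x) 0 0.

(** Square of [enorm]; avoiding the root keeps the estimates polynomial. *)
Definition sqnorm n (x : 'cV[R]_n) : R := \sum_i x i 0 ^+ 2.

Lemma qformE n (M : 'M[R]_n) x :
  qform M x = \sum_j \sum_i x i 0 * M i j * x j 0.
Proof.
rewrite /qform mxE; apply: eq_bigr => j _; rewrite mxE mulr_suml.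
by apply: eq_bigr => i _; rewrite mxE.
Qed.

Lemma sqnorm0 n : sqnorm (0 : 'cV[R]_n) = 0.
Proof. by rewrite /sqnorm big1// => i _; rewrite mxE expr0n. Qed.

Lemma sqnorm_col_mx m n (x : 'cV[R]_m) (y : 'cV[R]_n) :
  sqnorm (col_mx x y) = sqnorm x + sqnorm y.
Proof.
rewrite /sqnorm big_split_ord/=.
by congr (_ + _); apply: eq_bigr => i _; rewrite ?col_mxEd ?col_mxEu.
Qed.

Lemma sqnorm_ge0 n (x : 'cV[R]_n) : 0 <= sqnorm x.
Proof. by apply: sumr_ge0 => i _; exact: sqr_ge0. Qed.

Lemma sqnormE n (x : 'cV[R]_n) : sqnorm x = (x^T *m x) 0 0.
Proof. by rewrite mxE; apply: eq_bigr => i _; rewrite mxE expr2. Qed.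

Lemma qformD n (M N : 'M[R]_n) x : qform (M + N) x = qform M x + qform N x.
Proof. by rewrite /qform mulmxDr mulmxDl mxE. Qed.

Lemma qformN n (M : 'M[R]_n) x : qform (- M) x = - qform M x.
Proof. by rewrite /qform mulmxN mulNmx mxE. Qed.

Lemma qformZ n k (M : 'M[R]_n) x : qform (k *: M) x = k * qform M x.
Proof. by rewrite /qform -scalemxAr -scalemxAl mxE. Qed.

Lemma qform_sum n (I : Type) (r : seq I) (F : I -> 'M[R]_n) x :
  qform (\sum_(i <- r) F i) x = \sum_(i <- r) qform (F i) x.
Proof. by rewrite /qform mulmx_sumr mulmx_suml summxE. Qed.

Lemma qform_scalar n k (x : 'cV[R]_n) : qform k%:M x = k * sqnorm x.
Proof. by rewrite /qform mul_mx_scalar -scalemxAl mxE sqnormE. Qed.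

Lemma qform_congr m n (P : 'M[R]_(m, n)) (M : 'M[R]_m) x :
  qform (P^T *m M *m P) x = qform M (P *m x).
Proof. by rewrite /qform trmx_mul !mulmxA. Qed.

Lemma qform_gram m n (P : 'M[R]_(m, n)) x : qform (P^T *m P) x = sqnorm (P *m x).
Proof. by rewrite sqnormE /qform trmx_mul !mulmxA. Qed.

(* Equivalent to qform M (v + 2 r) >= 0. *)
Lemma qform_perturb n (M : 'M[R]_n) (v r : 'cV[R]_n) : psdmx M ->
  2^-1 * qform M v - qform M r <= qform M (v + r).
Proof.
move=> [MT M0]; have := M0 (v + 2 *: r); rewrite -/(qform M _).
have symE : (r^T *m M *m v) 0 0 = (v^T *m M *m r) 0 0.
  have -> : r^T *m M *m v = (v^T *m M *m r)^T.
    by rewrite !trmx_mul trmxK MT mulmxA.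
  by rewrite mxE.
have expand (k : R) : qform M (v + k *: r) =
    qform M v + 2 * k * (v^T *m M *m r) 0 0 + k ^+ 2 * qform M r.
  have trE : (v + k *: r)^T = v^T + k *: r^T.
    by apply/matrixP => i j; rewrite !mxE.
  rewrite /qform trE !mulmxDl !mulmxDr -!scalemxAr -!scalemxAl.
  move: symE; move: (r^T *m M *m v) (v^T *m M *m r) (v^T *m M *m v).
  move: (r^T *m M *m r) => a b c d symE; rewrite !mxE symE; ring.
rewrite expand -[in X in _ -> X](scale1r r) expand scale1r; lra.
Qed.

(** The form is a finite linear combination of the entries of [F s], so it passes under the
    integral. This turns Gramian matrices into scalar integrals. *)
Lemma qform_integralmx n a b (F : R -> 'M[R]_n) x :
  bounded_measurable_mx `[a, b] F ->
  qform (integralmx `[a, b] F) x =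
  \int[lebesgue_measure]_(s in `[a, b]) qform (F s) x.
Proof.
move=> FD; under eq_Rintegral do rewrite qformE.
have bm i j : bounded_measurable `[a, b] (fun s => x i 0 * F s i j * x j 0).
  apply: bounded_measurableM; last exact: bounded_measurable_cst.
  apply: bounded_measurableM; [exact: bounded_measurable_cst|exact: FD].
rewrite qformE Rintegral_sum; last first.
  by move=> j; exact: bounded_measurable_sum.
apply: eq_bigr => j _; rewrite Rintegral_sum//; apply: eq_bigr => i _.
rewrite mxE RintegralZr//; last first.
  apply: integrable_bounded_measurable; apply: bounded_measurableM => //.
  exact: bounded_measurable_cst.
by rewrite RintegralZl//; exact: integrable_bounded_measurable.
Qed.

Lemma bounded_measurable_qform n D (F : R -> 'M[R]_n) (v : R -> 'cV[R]_n) :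
  bounded_measurable_mx D F -> bounded_measurable_mx D v ->
  bounded_measurable D (fun s => qform (F s) (v s)).
Proof.
move=> FD vD; apply: (bounded_measurable_mulmx (F := fun s => (v s)^T *m F s)) => //.
by apply: bounded_measurable_mulmx => //; exact: bounded_measurable_tr.
Qed.

(** Symmetry is part of [psdmx], and subtracting a scalar matrix does not affect it; the rest of the
    order is a scalar inequality for each vector. *)
Lemma loewner_le_scalarP n mu (M : 'M[R]_n) :
  loewner_le mu%:M M <-> M^T = M /\ forall x, mu * sqnorm x <= qform M x.
Proof.
rewrite /loewner_le /psdmx linearB/= tr_scalar_mx; split=> -[MT M0]; split.
- by move/addIr: MT.
- by move=> x; rewrite -subr_ge0 -qform_scalar -qformN -qformD; exact: M0.
- by rewrite MT.
- by move=> x; rewrite -/(qform _ _) qformD qformN qform_scalar subr_ge0.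
Qed.

End QuadraticForms.

(** * Quadratic curves: interpolation at three points and drift over a short window *)

Section Trajectories.
Context {R : realType}.

(** First component of the solution of x1' = x2, x2' = x3, x3' = 0 at time tau. *)
Definition quad_traj n (x1 x2 x3 : 'cV[R]_n) (tau : R) : 'cV[R]_n :=
  x1 + tau *: x2 + (tau ^+ 2 / 2) *: x3.

Lemma bounded_measurable_shift (a b t : R) :
  bounded_measurable `[a, b] (fun s => s - t) /\
  bounded_measurable `[a, b] (fun s => (s - t) ^+ 2 / 2).
Proof.
have tau := bounded_measurableD (bounded_measurable_id a b)
  (bounded_measurable_cst `[a, b] (- t)).
split=> //; apply: bounded_measurableM (bounded_measurable_cst _ _).
exact: bounded_measurableM.
Qed.

Lemma bounded_measurable_quad_traj n (x1 x2 x3 : 'cV[R]_n) a b t :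
  bounded_measurable_mx `[a, b] (fun s => quad_traj x1 x2 x3 (s - t)).
Proof.
have [tau tau2] := bounded_measurable_shift a b t.
have cst := bounded_measurable_cstmx `[a, b].
apply: bounded_measurable_addmx; last exact: bounded_measurable_scalemx.
apply: bounded_measurable_addmx; first exact: cst.
exact: bounded_measurable_scalemx.
Qed.

(** Taylor expansion at c: the increment is again such a curve, starting at 0 with the velocity
    [x2 + c *: x3] reached at c. *)
Lemma quad_traj_shift n (x1 x2 x3 : 'cV[R]_n) c sigma :
  quad_traj x1 x2 x3 (c + sigma) =
  quad_traj x1 x2 x3 c + quad_traj 0 (x2 + c *: x3) x3 sigma.
Proof. by apply/matrixP => i j; rewrite !mxE; field. Qed.

(** The values at 0, u and 2u determine the three coefficients through finite differences,
    coordinate by coordinate. *)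
Lemma sqnorm_quad_traj_interp n (x1 x2 x3 : 'cV[R]_n) (u : R) :
  sqnorm x1 + u ^+ 2 * sqnorm x2 + u ^+ 4 / 4 * sqnorm x3 <=
  9 * (sqnorm (quad_traj x1 x2 x3 0) + sqnorm (quad_traj x1 x2 x3 u) +
       sqnorm (quad_traj x1 x2 x3 (2 * u))).
Proof.
rewrite /sqnorm !mulr_sumr -!big_split/= mulr_sumr; apply: ler_sum => i _.
rewrite !mxE; move: (x1 i 0) (x2 i 0) (x3 i 0) => a b c.
have [q1 Eq1] : exists q, q = a + u * b + u ^+ 2 / 2 * c by eexists.
have [q2 Eq2] : exists q, q = a + 2 * u * b + (2 * u) ^+ 2 / 2 * c by eexists.
(* One-sided first difference for u b, then second difference for u^2 c / 2; both are exact on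
   quadratic polynomials. *)
have Eb : u ^+ 2 * b ^+ 2 = ((- 3 * a + 4 * q1 - q2) / 2) ^+ 2.
  by rewrite Eq1 Eq2; field.
have Ec : u ^+ 4 / 4 * c ^+ 2 = ((a - 2 * q1 + q2) / 2) ^+ 2.
  by rewrite Eq1 Eq2; field.
rewrite Eb Ec -Eq1 -Eq2 mul0r addr0 expr0n/= !mul0r addr0.
(* With the constant 9 the difference of the two sides is a positive form in a, q1, q2: the first
   square eliminates q2, the second the product of q1 and a, and positive multiples of a^2 and q1^2
   remain. *)
have := sqr_ge0 (17 * q2 + 3 * q1 - 2 * a); have := sqr_ge0 (q1 + a).
have := sqr_ge0 a; have := sqr_ge0 q1; lra.
Qed.

(** The increment is sigma x2 + (c sigma + sigma^2/2) x3. Measured on the scale u = K delta, both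
    coefficients are small of order 1/K, whence the factor 1/K^2. *)
Lemma sqnorm_quad_traj_step n (x2 x3 : 'cV[R]_n) (K delta c sigma : R) :
  1 <= K -> 0 <= sigma <= delta -> 0 <= c <= 2 * (K * delta) ->
  sqnorm (quad_traj 0 (x2 + c *: x3) x3 sigma) <=
  50 / K ^+ 2 * ((K * delta) ^+ 2 * sqnorm x2 +
                 (K * delta) ^+ 4 / 4 * sqnorm x3).
Proof.
move=> K1 /andP[s0 sd] /andP[c0 cK].
have K0 : K != 0 by rewrite gt_eqF// (lt_le_trans _ K1).
(* The term in x3 fixes the constant: 50/4 = 2 (5/2)^2. For x2 a factor 2 would suffice. *)
have -> : 50 / K ^+ 2 * ((K * delta) ^+ 2 * sqnorm x2 +
    (K * delta) ^+ 4 / 4 * sqnorm x3) =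
    50 * delta ^+ 2 * sqnorm x2 +
    2 * (5 / 2 * (K * delta ^+ 2)) ^+ 2 * sqnorm x3 by field.
rewrite /sqnorm !mulr_sumr -!big_split/=; apply: ler_sum => i _.
rewrite !mxE; move: (x2 i 0) (x3 i 0) => a b.
have E : 0 + sigma * (a + c * b) + sigma ^+ 2 / 2 * b =
    sigma * a + (c * sigma + sigma ^+ 2 / 2) * b by ring.
have d0 : 0 <= delta by exact: le_trans sd.
have s2 : sigma ^+ 2 <= delta ^+ 2 by rewrite lerXn2r ?nnegrE.
have cs : c * sigma <= 2 * (K * delta) * delta by rewrite ler_pM.
have g0 : 0 <= c * sigma + sigma ^+ 2 / 2.
  by rewrite addr_ge0 ?mulr_ge0 ?divr_ge0 ?sqr_ge0.
have Kd : delta ^+ 2 <= K * delta ^+ 2 by rewrite ler_peMl ?sqr_ge0.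
have g1 : c * sigma + sigma ^+ 2 / 2 <= 5 / 2 * (K * delta ^+ 2).
  have -> : 5 / 2 * (K * delta ^+ 2) =
    2 * (K * delta) * delta + K * delta ^+ 2 / 2 by field.
  by lra.
have g2 : (c * sigma + sigma ^+ 2 / 2) ^+ 2 <= (5 / 2 * (K * delta ^+ 2)) ^+ 2.
  by rewrite lerXn2r ?nnegrE// (le_trans g0).
rewrite E; move: (c * sigma + _) (5 / 2 * _) g2 => g h g2.
have := ler_wpM2r (sqr_ge0 a) s2; have := ler_wpM2r (sqr_ge0 b) g2.
(* This square gives (sigma a + g b)^2 <= 2 sigma^2 a^2 + 2 g^2 b^2. *)
have := sqr_ge0 (sigma * a - g * b); have := mulr_ge0 (sqr_ge0 delta) (sqr_ge0 a).
rewrite sqrrB sqrrD !exprMn; lra.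
Qed.

End Trajectories.

(** * From excitation of constant vectors to excitation of quadratic curves *)

Section Persistence.
Context {R : realType} (d : nat) (F : R -> 'M[R]_d) (B delta mu : R).
Context (delta_gt0 : 0 < delta).
Context (mu_gt0 : 0 < mu).
Context (B_ge0 : 0 <= B).
Context (F_psd : forall s, 0 <= s -> psdmx (F s)).
Context (F_le : forall s x, 0 <= s -> qform (F s) x <= B * sqnorm x).
Context (F_bm : bounded_measurable_mx `[0, +oo[ F).
Context (F_PE : forall t x, 0 <= t ->
  mu * sqnorm x <= \int[lebesgue_measure]_(s in `[t, t + delta]) qform (F s) x).

Let F_bm_itv a b : 0 <= a -> bounded_measurable_mx `[a, b] F.
Proof.
move=> a0 i j; apply: sub_bounded_measurable (F_bm i j) => //.
by apply: subset_itv; rewrite bnd_simp.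
Qed.

(** Excitation only concerns constant vectors. Integrating [qform_perturb] keeps half of it for v +
    r, up to an error controlled by the size of r. *)
Lemma window_lower_bound t e (v : 'cV[R]_d) (r : R -> 'cV[R]_d) : 0 <= t ->
  bounded_measurable_mx `[t, t + delta] r ->
  (forall s, `[t, t + delta]%classic s -> sqnorm (r s) <= e) ->
  2^-1 * mu * sqnorm v - B * e * delta <=
  \int[lebesgue_measure]_(s in `[t, t + delta]) qform (F s) (v + r s).
Proof.
move=> t0 rbm re.
have Fbm := F_bm_itv (t + delta) t0.
have vbm := bounded_measurable_cstmx `[t, t + delta] v.
have bm1 := bounded_measurable_qform Fbm vbm.
have cst k : bounded_measurable `[t, t + delta] (fun=> k : R).
  exact: bounded_measurable_cst.
have bm2 := bounded_measurableM (cst 2^-1) bm1.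
have ge s : `[t, t + delta]%classic s ->
    2^-1 * qform (F s) v + - (B * e) <= qform (F s) (v + r s).
  move=> ts; have s0 : 0 <= s.
    by move: ts; rewrite /= in_itv/= => /andP[/(le_trans t0)].
  have := qform_perturb v (r s) (F_psd s0); have := F_le (r s) s0.
  have := ler_wpM2l B_ge0 (re _ ts); lra.
apply: le_trans (le_Rintegral (mu := lebesgue_measure) _ _ _ ge) => //.
- rewrite RintegralD//; last 2 first.
  + exact: integrable_bounded_measurable.
  + exact: integrable_bounded_measurable.
  rewrite RintegralZl//; last exact: integrable_bounded_measurable.
  rewrite (Rintegral_cst_itv _ _ (ltW delta_gt0)); have := F_PE v t0; lra.
- by apply: integrable_bounded_measurable; exact: bounded_measurableD.
- apply: integrable_bounded_measurable; apply: bounded_measurable_qform => //.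
  exact: bounded_measurable_addmx.
Qed.

(** Three window estimates are added, and [sqnorm_quad_traj_interp] recovers the initial data from
    the values at the left ends. *)
Lemma quad_traj_observable : exists delta' mu' : R,
  [/\ 0 < delta', 0 < mu' & forall t x1 x2 x3, 0 <= t ->
    mu' * (sqnorm x1 + sqnorm x2 + sqnorm x3) <=
    \int[lebesgue_measure]_(s in `[t, t + delta'])
       qform (F s) (quad_traj x1 x2 x3 (s - t))].
Proof.
(* The summand absorbs the perturbation terms of the three windows, see Kmu. *)
pose K : R := 1 + 60 * 90 * B * delta / mu.
have K1 : 1 <= K.
  by rewrite lerDl divr_ge0 ?mulr_ge0// ltW.
have K0 : 0 < K by exact: lt_le_trans K1.
(* Each window loses 50 B delta / K^2 times N (defined below), hence 150 = 3 * 50. The main terms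
   add up to at least mu/18 times N, as mu/2 meets the interpolation constant 9; half of this is
   left for the losses. Since K >= 1, the bound by K suffices for K^2. *)
have Kmu : 150 * B * delta / K ^+ 2 <= mu / 36.
  rewrite ler_pdivrMr ?exprn_gt0//.
  have : mu / 36 * K <= mu / 36 * K ^+ 2.
    by rewrite ler_pM2l ?divr_gt0// expr2 ler_peMl// ltW.
  have -> : mu / 36 * K = mu / 36 + 150 * B * delta.
    by rewrite /K; field; rewrite gt_eqF.
  have : 0 <= mu / 36 by rewrite divr_ge0// ltW.
  lra.
pose u := K * delta.
have u0 : 0 < u by rewrite mulr_gt0.
(* Smallest weight in N, used to return to the unweighted sum of squared norms. *)
pose m : R := Num.min 1 (Num.min (u ^+ 2) (u ^+ 4 / 4)).
have m0 : 0 < m by rewrite !lt_min ltr01 !divr_gt0 ?exprn_gt0.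
(* The interval ends with the third window, and 108 = 3 * 36 because each window integral is bounded
   by the whole integral I. *)
exists (2 * u + delta), (mu / 108 * m); split.
- by rewrite addr_gt0// mulr_gt0.
- by rewrite mulr_gt0// divr_gt0.
move=> t x1 x2 x3 t0.
pose N := sqnorm x1 + u ^+ 2 * sqnorm x2 + u ^+ 4 / 4 * sqnorm x3.
pose I := \int[lebesgue_measure]_(s in `[t, t + (2 * u + delta)])
  qform (F s) (quad_traj x1 x2 x3 (s - t)).
have window c : 0 <= c <= 2 * u ->
    2^-1 * mu * sqnorm (quad_traj x1 x2 x3 c) - B * (50 / K ^+ 2 * N) * delta
    <= I.
  move=> /andP[c0 cu]; have tc0 : 0 <= t + c by rewrite addr_ge0.
  (* Deviation of the curve from its value at the left end t + c of the window. *)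
  pose r s := quad_traj 0 (x2 + c *: x3) x3 (s - (t + c)).
  have := @window_lower_bound (t + c) (50 / K ^+ 2 * N)
    (quad_traj x1 x2 x3 c) r tc0.
  move=> /(_ (bounded_measurable_quad_traj _ _ _ _ _ _)) /(_ _)/le_trans; apply.
    move=> s; rewrite /= in_itv/= => /andP[cs sc].
    apply: le_trans (@sqnorm_quad_traj_step _ _ _ _ K delta _ _ K1 _ _) _.
    - by rewrite subr_ge0 cs lerBlDl.
    - by rewrite c0.
    rewrite ler_wpM2l ?divr_ge0 ?sqr_ge0// -/u /N.
    by have := sqnorm_ge0 x1; lra.
  under eq_Rintegral => s _.
    rewrite /r -quad_traj_shift (_ : c + (s - (t + c)) = s - t); last by ring.
    over.
  apply: Rintegral_subset.
  - by rewrite lerDl.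
  - by rewrite -addrA lerD2l lerD2r.
  - move=> s; rewrite /= in_itv/= => /andP[ts _].
    by have [_] := F_psd (le_trans t0 ts); apply.
  - apply: bounded_measurable_qform; first exact: F_bm_itv.
    exact: bounded_measurable_quad_traj.
have u2 : 0 <= 2 * u by rewrite mulr_ge0// ltW.
have uu : u <= 2 * u by rewrite ler_peMl ?ler1n// ltW.
have /window w0 : 0 <= (0 : R) <= 2 * u by rewrite lexx.
have /window w1 : 0 <= u <= 2 * u by rewrite ltW.
have /window w2 : 0 <= 2 * u <= 2 * u by rewrite u2 lexx.
(* Sum of the three windows: 3 I >= (mu/18 - mu/36) N. *)
have NI : mu / 108 * N <= I.
  have Nq : N <= _ := sqnorm_quad_traj_interp x1 x2 x3 u.
  have N0 : 0 <= N.
    by rewrite !addr_ge0 ?mulr_ge0 ?divr_ge0 ?exprn_ge0 ?sqnorm_ge0// ltW.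
  have := ler_wpM2l (ltW mu_gt0) Nq; have := ler_wpM2r N0 Kmu.
  have -> : 150 * B * delta / K ^+ 2 * N = 3 * (B * (50 / K ^+ 2 * N) * delta).
    by field; rewrite gt_eqF.
  move: w0 w1 w2; lra.
apply: le_trans NI; rewrite -mulrA ler_pM2l ?divr_gt0// !mulrDr.
have m1 : m <= 1 by rewrite ge_min lexx.
have m2 : m <= u ^+ 2 by rewrite !ge_min lexx orbT.
have m3 : m <= u ^+ 4 / 4 by rewrite !ge_min lexx !orbT.
have := ler_wpM2r (sqnorm_ge0 x1) m1; have := ler_wpM2r (sqnorm_ge0 x2) m2.
have := ler_wpM2r (sqnorm_ge0 x3) m3; rewrite /N; lra.
Qed.

End Persistence.


(** * The transition matrix of the nilpotent system *)

Section DoubleIntegrator.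
Context {R : realType}.

(** The partial sums of the exponential series are constant from index 3 on, so this constant is the
    limit. *)
Lemma expmx_nilpotent3 n (M : 'M[R]_n) : M ^+ 3 = 0 ->
  expmx M = 1%:M + M + 2^-1 *: M ^+ 2.
Proof.
move=> M3; apply: norm_lim_near_cst; near=> N.
have N3 : (3 <= N)%N by near: N; exact: nbhs_infty_ge.
rewrite /series/= (big_cat_nat (n := 3))//= [X in _ + X]big_nat_cond.
rewrite [X in _ + X]big1 => [|k /andP[/andP[k3 _] _]]; last first.
  by rewrite -(subnK k3) exprD M3 mulr0 scaler0.
rewrite addr0 big_mkord !big_ord_recl big_ord0/= addr0 addrA.
by rewrite expr0 expr1 fact0 invr1 !scale1r.
Unshelve. all: by end_near. Qed.

Lemma Amx_mul_col (x1 x2 x3 : 'cV[R]_3) :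
  Amx *m col_mx x1 (col_mx x2 x3) = col_mx x2 (col_mx x3 0).
Proof.
rewrite /Amx mul_block_col mul_row_col mul_block_col.
by rewrite !mul0mx !mul1mx !(addr0, add0r).
Qed.

Lemma Amx_cube : (Amx : 'M[R]_(3 + (3 + 3))) ^+ 3 = 0.
Proof.
rewrite !exprS expr0 mulr1 -[LHS]/(Amx *m (Amx *m Amx)) /Amx.
rewrite !mulmx_block !mul_row_block.
rewrite !mul_mx_row.
rewrite !(mul0mx, mul1mx, mulmx0, mulmx1, addr0, add0r, row_mx0, add_row_mx).
by rewrite !(mul0mx, mulmx0, mulmx1, addr0, row_mx0, block_mx0).
Qed.

Lemma transition_Amx (s t : R) : transition Amx s t =
  1%:M + (s - t) *: Amx + ((s - t) ^+ 2 / 2) *: Amx ^+ 2.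
Proof.
rewrite /transition expmx_nilpotent3 ?exprZn ?Amx_cube ?scaler0//.
by rewrite scalerA mulrC.
Qed.

(** [Cmx P] reads only the position block, and the position block of the propagated state is the
    quadratic curve. *)
Lemma Cmx_transition m (P : 'M[R]_(m, 3)) s t (x1 x2 x3 : 'cV[R]_3) :
  Cmx P *m (transition Amx s t *m col_mx x1 (col_mx x2 x3)) =
  P *m quad_traj x1 x2 x3 (s - t).
Proof.
rewrite transition_Amx -[Amx ^+ 2]/(Amx *m Amx) !mulmxDl mul1mx.
rewrite -!scalemxAl -mulmxA.
rewrite !Amx_mul_col !scale_col_mx !add_col_mx /Cmx mul_row_col.
by rewrite mul_row_col !mul0mx !addr0.
Qed.

Lemma bounded_measurable_transition_Amx (a b t : R) :
  bounded_measurable_mx `[a, b] (fun s => transition Amx s t).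
Proof.
have [tau tau2] := bounded_measurable_shift a b t.
have cst M : bounded_measurable_mx `[a, b] (fun=> M : 'M[R]_(3 + (3 + 3))).
  exact: bounded_measurable_cstmx.
have -> : (fun s => transition Amx s t) = (fun s =>
    1%:M + (s - t) *: Amx + ((s - t) ^+ 2 / 2) *: Amx ^+ 2).
  by apply/funext => s; exact: transition_Amx.
apply: bounded_measurable_addmx; last exact: bounded_measurable_scalemx.
by apply: bounded_measurable_addmx => //; exact: bounded_measurable_scalemx.
Qed.

End DoubleIntegrator.

(** * Projections onto bearing-orthogonal planes; the Gram matrix and measurability of the output *)

Section Bearings.
Context {R : realType}.
Implicit Types z x c : 'cV[R]_3.

Lemma enorm_eq0 n (v : 'cV[R]_n) : enorm v = 0 -> v = 0.
Proof.
move=> /eqP; rewrite sqrtr_eq0 => v0; apply/matrixP => i j; rewrite ord1 mxE.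
have /psumr_eq0P v0' : \sum_i v i 0 ^+ 2 = 0.
  by apply/eqP; rewrite eq_le v0 sumr_ge0// => k _; exact: sqr_ge0.
by apply/eqP; rewrite -sqrf_eq0; apply/eqP/v0' => // k _; exact: sqr_ge0.
Qed.

Lemma ler_enorm n (v : 'cV[R]_n) i : `|v i 0| <= enorm v.
Proof.
rewrite -sqrtr_sqr ler_wsqrtr// (bigD1 i)//= lerDl.
by apply: sumr_ge0 => j _; exact: sqr_ge0.
Qed.

Lemma unit_enormV n (v : 'cV[R]_n) : v != 0 ->
  ((enorm v)^-1 *: v)^T *m ((enorm v)^-1 *: v) = 1%:M.
Proof.
move=> v0; have ev0 : enorm v != 0 by apply: contra_neq v0; exact: enorm_eq0.
rewrite [LHS]mx11_scalar -sqnormE /sqnorm; congr (_%:M).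
under eq_bigr do rewrite mxE exprMn.
rewrite -mulr_sumr exprVn -[X in _ * X]sqr_sqrtr -/(enorm v) ?mulVf//.
  by rewrite sqrf_eq0.
by apply: sumr_ge0 => j _; exact: sqr_ge0.
Qed.

Lemma tr_Pi z : (Pi z)^T = Pi z.
Proof. by rewrite /Pi linearB/= trmx1 trmx_mul trmxK. Qed.

Lemma Pi_idem z : z^T *m z = 1%:M -> Pi z *m Pi z = Pi z.
Proof.
move=> z1; rewrite /Pi mulmxBr mulmx1 mulmxBl mul1mx.
by rewrite mulmxA -(mulmxA z) z1 mulmx1 subrr subr0.
Qed.

(** Moves the projection from the frame of a camera to the common frame. *)
Lemma Pi_rot (O : 'M[R]_3) z : O *m O^T = 1%:M ->
  Pi (O *m z) = O *m Pi z *m O^T.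
Proof.
by move=> OO; rewrite /Pi mulmxBr mulmxBl mulmx1 OO trmx_mul !mulmxA.
Qed.

Lemma qform_rank1 n (z r : 'cV[R]_n) : qform (z *m z^T) r = (z^T *m r) 0 0 ^+ 2.
Proof.
rewrite -[z in z *m _]trmxK qform_gram /sqnorm big_ord_recl big_ord0 addr0.
by [].
Qed.

Lemma qform_Pi_le z r : qform (Pi z) r <= sqnorm r.
Proof.
by rewrite qformD qformN qform_rank1 qform_scalar mul1r gerBl sqr_ge0.
Qed.

Lemma qform_e3_le (r : 'cV[R]_3) : qform (e3 *m e3^T) r <= sqnorm r.
Proof.
rewrite qform_rank1 /e3 trmx_delta -rowE mxE /sqnorm (bigD1 ord_max)//= lerDl.
by apply: sumr_ge0 => j _; exact: sqr_ge0.
Qed.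

Lemma bearing_unit (O : 'M[R]_3) c x : SO3 O -> x <> c ->
  (bearing O c x)^T *m bearing O c x = 1%:M.
Proof.
move=> [/mulmx1C OO _] xc; rewrite /bearing trmx_mul trmxK mulmxA -(mulmxA _ O).
by rewrite OO mulmx1 unit_enormV// subr_eq0; apply/eqP.
Qed.

(** A camera block contributes R Pi(y) Pi(y) R^T, which is R Pi(y) R^T = Pi(R y) because y is a unit
    vector and R is orthogonal. *)
Lemma Cp_gram n (alt : bool) (Q : 'I_n -> 'M[R]_3) (c : 'I_n -> 'cV[R]_3) x :
  (forall i, SO3 (Q i)) -> (forall i, x <> c i) ->
  (Cp alt Q c x)^T *m Cp alt Q c x =
  \sum_(i < n) Pi (Q i *m bearing (Q i) (c i) x) + alt%:R *: (e3 *m e3^T).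
Proof.
move=> QSO xc; rewrite /Cp tr_col_mx mul_row_col tr_mxcol mul_mxrow_mxcol.
congr (_ + _).
  apply: eq_bigr => i _; rewrite trmx_mul trmxK tr_Pi mulmxA -(mulmxA (Q i)).
  rewrite Pi_idem; last exact: bearing_unit.
  by rewrite Pi_rot//; have [/mulmx1C] := QSO i.
(* Without altimeter the last block has no row, so its Gram matrix is 0. *)
case: alt => /=; last by rewrite scale0r [X in _ *m X]flatmx0 mulmx0.
rewrite scale1r (_ : \matrix_(k < _, j < _) _ = e3^T) ?trmxK//.
by apply/matrixP => k j; rewrite mxE ord1.
Qed.

Lemma bounded_measurable_bearing D (O : 'M[R]_3) c (p : R -> 'cV[R]_3) :
  (forall j : 'I_3, measurable_fun D (fun t => p t j 0)) ->
  bounded_measurable_mx D (fun t => bearing O c (p t)).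
Proof.
move=> mp; apply: bounded_measurable_mulmx => [|i j].
  exact: bounded_measurable_cstmx.
rewrite ord1; apply: (@eq_bounded_measurable _ _ (fun t =>
  (enorm (p t - c))^-1 * (p t i 0 - c i 0))) => [t _|]; first by rewrite !mxE.
have mpc k : measurable_fun D (fun t => p t k 0 - c k 0).
  by apply: measurable_funB => //; exact: measurable_cst.
split.
  apply: measurable_funM => //.
  (* Writing the inverse norm as a power -1/2 of a sum of squares reduces its measurability to that
     of real powers; the identity also holds where the norm vanishes. *)
  have -> : (fun t => (enorm (p t - c))^-1) =
      (@powR R ^~ (- 2^-1)) \o (fun t => \sum_k (p t k 0 - c k 0) ^+ 2).
    apply/funext => t /=; rewrite powRN powR12_sqrt; last first.
      by apply: sumr_ge0 => k _; exact: sqr_ge0.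
    by congr (Num.sqrt _)^-1; apply: eq_bigr => k _; rewrite !mxE.
  apply: measurableT_comp; first exact: measurable_powR.
  by apply: measurable_sum => k; exact: measurable_funX.
exists 1 => t _; have := ler_enorm (p t - c) i; rewrite !mxE => pt.
(* By the convention that 0 has inverse 0, the bound 1 also holds at a camera position, so D may be
   any set. *)
have [->|e0] := eqVneq (enorm (p t - c)) 0; first by rewrite invr0 mul0r normr0.
have e_gt0 : 0 < enorm (p t - c) by rewrite lt_neqAle eq_sym e0 sqrtr_ge0.
by rewrite normrM normfV (gtr0_norm e_gt0) mulrC ler_pdivrMr// mul1r.
Qed.

Lemma bounded_measurable_Pi D (z : R -> 'cV[R]_3) :
  bounded_measurable_mx D z -> bounded_measurable_mx D (fun s => Pi (z s)).
Proof.
move=> zD; have zz := bounded_measurable_mulmx zD (bounded_measurable_tr zD).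
have -> : (fun s => Pi (z s)) = (fun s => 1%:M + (-1) *: (z s *m (z s)^T)).
  by apply/funext => s; rewrite scaleN1r.
apply: bounded_measurable_addmx; first exact: bounded_measurable_cstmx.
by apply: bounded_measurable_scalemx zz; exact: bounded_measurable_cst.
Qed.

Lemma bounded_measurable_Cp D n alt (Q : 'I_n -> 'M[R]_3) (c : 'I_n -> 'cV[R]_3)
    (p : R -> 'cV[R]_3) :
  (forall j : 'I_3, measurable_fun D (fun t => p t j 0)) ->
  bounded_measurable_mx D (fun t => Cp alt Q c (p t)).
Proof.
move=> mp; apply: bounded_measurable_col_mx; last exact: bounded_measurable_cstmx.
apply: bounded_measurable_mxcol => i; apply: bounded_measurable_mulmx.
  by apply: bounded_measurable_Pi; exact: bounded_measurable_bearing.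
exact: bounded_measurable_cstmx.
Qed.

End Bearings.

(** * Equivalence of uniform observability and persistent excitation *)

Theorem lemma3 (R : realType) (n : nat) (alt : bool)
    (p : R -> 'cV[R]_3) (c : 'I_n -> 'cV[R]_3) (Q : 'I_n -> 'M[R]_3)
    (p_meas : forall j : 'I_3, measurable_fun (`[0, +oo[ : set R) (fun t => p t j 0))
    (Q_SO3 : forall i, SO3 (Q i))
    (p_neq : forall t, 0 <= t -> forall i, p t <> c i) :
  let y (i : 'I_n) (t : R) := bearing (Q i) (c i) (p t) in
  uniformly_observable Amx (fun t => Cmx (Cp alt Q c (p t))) <->
  exists delta mu : R, [/\ 0 < delta, 0 < mu & forall t : R, 0 <= t ->
    loewner_le mu%:M
      (delta^-1 *: integralmx `[t, t + delta]
                     (fun s => \sum_(i < n) Pi (Q i *m y i s))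
       + (alt%:R : R) *: (e3 *m e3^T))].
Proof.
move=> y.
(* S is the integrand of the excitation condition; G adds the altimeter term and equals the Gram
   matrix of the output matrix at nonnegative times. *)
pose S (s : R) : 'M[R]_3 := \sum_(i < n) Pi (Q i *m y i s).
pose G (s : R) : 'M[R]_3 := S s + (alt%:R : R) *: (e3 *m e3^T).
pose C s := Cp alt Q c (p s).
have sub (t b : R) : 0 <= t -> `[t, b] `<=` (`[0, +oo[ : set R).
  by move=> t0; apply: subset_itv; rewrite bnd_simp.
have sub_ge0 (t b s : R) : 0 <= t -> `[t, b]%classic s -> 0 <= s.
  by move=> t0 /sub -/(_ t0); rewrite /= in_itv/= andbT.
have C_bm (t b : R) : 0 <= t -> bounded_measurable_mx `[t, b] C.
  move=> t0; apply: bounded_measurable_Cp => j.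
  by apply: measurable_funS (p_meas j) => //; exact: sub.
have S_bm D : (forall j : 'I_3, measurable_fun D (fun t => p t j 0)) ->
    bounded_measurable_mx D S.
  move=> mp i j; apply: (@eq_bounded_measurable _ _ (fun s =>
    \sum_(k < n) Pi (Q k *m y k s) i j)) => [s _|]; first by rewrite summxE.
  apply: bounded_measurable_sum => k; apply: bounded_measurable_Pi.
  apply: bounded_measurable_mulmx; last exact: bounded_measurable_bearing.
  exact: bounded_measurable_cstmx.
have S_bm_itv (t b : R) : 0 <= t -> bounded_measurable_mx `[t, b] S.
  move=> t0; apply: S_bm => j.
  by apply: measurable_funS (p_meas j) => //; exact: sub.
have G_bm : bounded_measurable_mx `[0, +oo[ G.
  apply: bounded_measurable_addmx; last exact: bounded_measurable_cstmx.
  exact: S_bm.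
have C_gram s : 0 <= s -> (C s)^T *m C s = G s.
  by move=> s0; exact: Cp_gram (p_neq _ s0).
have G_psd s : 0 <= s -> psdmx (G s).
  move=> s0; rewrite -C_gram//; split; first by rewrite trmx_mul trmxK.
  by move=> x; rewrite -/(qform _ _) qform_gram sqnorm_ge0.
(* Each of the n projections, and the altimeter term, is at most the identity. *)
have G_le s x : qform (G s) x <= (n%:R + 1) * sqnorm x.
  rewrite qformD qform_sum qformZ mulrDl mul1r lerD//.
    rewrite -[X in X%:R]card_ord mulr_natl -sumr_const.
    by apply: ler_sum => i _; exact: qform_Pi_le.
  have := qform_e3_le x; have := sqnorm_ge0 x.
  by case: (alt); rewrite ?mul1r ?mul0r.
(* The altimeter term is constant, hence equal to its average, and can be moved under the
   integral. *)
have PE_qform (t delta : R) x : 0 <= t -> 0 < delta ->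
    qform (delta^-1 *: integralmx `[t, t + delta] S
           + (alt%:R : R) *: (e3 *m e3^T)) x =
    delta^-1 * \int[lebesgue_measure]_(s in `[t, t + delta]) qform (G s) x.
  move=> t0 d0; rewrite qformD !qformZ qform_integralmx; last exact: S_bm_itv.
  under [in RHS]eq_Rintegral do rewrite qformD qformZ.
  rewrite RintegralD//; last 2 first.
  - apply: integrable_bounded_measurable.
    apply: bounded_measurable_qform; first exact: S_bm_itv.
    exact: bounded_measurable_cstmx.
  - by apply: integrable_bounded_measurable; exact: bounded_measurable_cst.
  by rewrite (Rintegral_cst_itv _ _ (ltW d0)) mulrDr mulrCA mulVf ?gt_eqF// mulr1.
pose W t s := (transition Amx s t)^T *m (Cmx (C s))^T *m Cmx (C s)
  *m transition Amx s t.
have W_qform t s x1 x2 x3 : 0 <= s ->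
    qform (W t s) (col_mx x1 (col_mx x2 x3)) =
    qform (G s) (quad_traj x1 x2 x3 (s - t)).
  move=> s0; rewrite /W -(mulmxA _ _ (Cmx _)) qform_congr qform_gram.
  by rewrite Cmx_transition -qform_gram C_gram.
have W_sym t s : (W t s)^T = W t s by rewrite /W !trmx_mul !trmxK !mulmxA.
have W_bm (t b : R) : 0 <= t -> bounded_measurable_mx `[t, b] (W t).
  move=> t0; have T_bm := bounded_measurable_transition_Amx t b t.
  have CC_bm : bounded_measurable_mx `[t, b] (fun s => Cmx (C s)).
    apply: bounded_measurable_row_mx; first exact: C_bm.
    exact: bounded_measurable_cstmx.
  apply: bounded_measurable_mulmx (T_bm).
  apply: bounded_measurable_mulmx (CC_bm).
  by apply: bounded_measurable_mulmx; exact: bounded_measurable_tr.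
have obs_qform (t b : R) x1 x2 x3 : 0 <= t ->
    qform (integralmx `[t, b] (W t)) (col_mx x1 (col_mx x2 x3)) =
    \int[lebesgue_measure]_(s in `[t, b])
      qform (G s) (quad_traj x1 x2 x3 (s - t)).
  move=> t0; rewrite qform_integralmx; last exact: W_bm.
  by apply: eq_Rintegral => s; rewrite inE => /(sub_ge0 _ _ _ t0); exact: W_qform.
split=> -[delta [mu [d0 mu0 obs]]].
(* On states (x, 0, 0) the curve is constant; the Gramian bound becomes the excitation bound after
   division by delta. *)
- exists delta, (mu / delta); split=> // [|t t0]; first exact: divr_gt0.
  have /loewner_le_scalarP[_ obs_t] := obs _ t0.
  apply/loewner_le_scalarP; split=> [|x].
    have ST s : (S s)^T = S s.
      by rewrite /S linear_sum/=; apply: eq_bigr => i _; exact: tr_Pi.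
    rewrite linearD/= !linearZ/= trmx_mul trmxK; congr (_ *: _ + _).
    apply/matrixP => i j; rewrite !mxE; apply: eq_Rintegral => s _.
    by rewrite -/(S s) -[in RHS]ST mxE.
  rewrite PE_qform// mulrAC mulrC ler_pM2l ?invr_gt0//.
  have obs_x : mu * sqnorm (col_mx x (col_mx 0 0)) <=
    qform (integralmx `[t, t + delta] (W t)) (col_mx x (col_mx 0 0)) := obs_t _.
  move: obs_x; rewrite !sqnorm_col_mx !sqnorm0 !addr0 (obs_qform _ _ _ _ _ t0).
  move=> /le_trans; apply; rewrite le_eqVlt; apply/orP; left; apply/eqP.
  by apply: eq_Rintegral => s _; rewrite /quad_traj !scaler0 !addr0.
(* The average is turned into an integral, so the excitation constant passed on is delta mu. *)
- have PE (t : R) x : 0 <= t -> delta * mu * sqnorm x <=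
      \int[lebesgue_measure]_(s in `[t, t + delta]) qform (G s) x.
    move=> t0; have /loewner_le_scalarP[_ /(_ x)] := obs _ t0.
    by rewrite PE_qform// [delta^-1 * _]mulrC ler_pdivlMr// mulrC mulrA.
  have [delta' [mu' [d0' mu0' obs']]] := quad_traj_observable d0
    (mulr_gt0 d0 mu0) (addr_ge0 (ler0n _ n) ler01) G_psd (fun s x _ => G_le s x)
    G_bm PE.
  exists delta', mu'; split=> // t t0; apply/loewner_le_scalarP; split=> [|x].
    apply/matrixP => i j; rewrite [LHS]mxE [LHS]mxE [RHS]mxE.
    by apply: eq_Rintegral => s _; rewrite -/(W t s) -[in RHS]W_sym [RHS]mxE.
  (* The state is split into its position, velocity and acceleration blocks. *)
  rewrite -[x]vsubmxK -[dsubmx x]vsubmxK !sqnorm_col_mx addrA.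
  have := obs' t (usubmx x) (usubmx (dsubmx x)) (dsubmx (dsubmx x)) t0.
  by rewrite -(obs_qform _ _ _ _ _ t0).
Qed.
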